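(* Let $X$ and $Y$ be Banach spaces. If the pair $(X,Y)$ has property $(sO^* )$ and the weak maximizing property (WMP), then $(Y^*,X^* )$ has the weak* to weak* maximizing property (weak*-to-weak*MP). In particular, whenever $Y$ is reflexive, the same conclusion holds if $(X,Y)$ has property $(O^* )$ and the WMP.
   Context: The scalar field is $\mathbb{R}$ or $\mathbb{C}$; $\mathcal{L}(X,Y)$ is the Banach space of bounded linear operators; a contraction is an operator of norm at most $1$; $B_X$ is the closed unit ball. A contraction $T\in\mathcal{L}(X,Y)$ has property $(sO^* )$ if for every non-zero $y^*\in Y^*$ and every bounded weakly* null net $(y^*_\alpha)\subset Y^*$ one has $\limsup_\alpha\|T^*y^*_\alpha\|<\limsup_\alpha\|y^*+y^*_\alpha\|$. It has property $(O^* )$ if the same holds for every weakly* null sequence $(y_n^* )\subset Y^*$ in place of nets. The pair $(X,Y)$ has property $(sO^* )$ (respectively $(O^* )$) if every contraction in $\mathcal{L}(X,Y)$ has it. An operator attains its norm if its norm is attained at some point of the unit sphere of its domain. A maximizing sequence of an operator $S$ is a sequence $(u_n)$ in the closed unit ball of its domain with $\lim_n\|Su_n\|=\|S\|$. The pair $(X,Y)$ has the WMP if every $T\in\mathcal{L}(X,Y)$ having a maximizing sequence that is not weakly null attains its norm. The pair $(Y^*,X^* )$ has the weak*-to-weak*MP if for every $T\in\mathcal{L}(X,Y)$ whose adjoint $T^*$ has a maximizing sequence in $B_{Y^*}$ that is not weakly* null, $T^*$ attains its norm. *)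

(* Defs.v *)
From HB Require Import structures.
From mathcomp Require Import all_boot all_order all_algebra.
From mathcomp Require Import complex.
From mathcomp Require Import all_classical all_reals all_analysis.

Set Implicit Arguments.
Unset Strict Implicit.
Unset Printing Implicit Defensive.

Import Order.TTheory GRing.Theory Num.Theory.
Import numFieldNormedType.Exports.

Local Open Scope classical_set_scope.
Local Open Scope ring_scope.

Inductive scalar_kind := RealScalars | ComplexScalars.

Definition scalar_field (R : realType) (s : scalar_kind) : numFieldType :=
  match s with
  | RealScalars => R : numFieldType
  | ComplexScalars => R[i] : numFieldType
  end.

(* Norms in a normed module over the scalar field K take their values in K. [real_part] and
   [of_real] transport them to R and back, where suprema exist. *)
Definition real_part (R : realType) (s : scalar_kind) :
    scalar_field R s -> R :=
  match s return scalar_field R s -> R with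
  | RealScalars => fun x => x
  | ComplexScalars => fun z => complex.Re z
  end.

Definition of_real (R : realType) (s : scalar_kind) :
    R -> scalar_field R s :=
  match s return R -> scalar_field R s with
  | RealScalars => fun x => x
  | ComplexScalars => fun x => (x%:C)%C
  end.

Arguments real_part {R s} _.
Arguments of_real {R s} _.

Section ScalarTheory.
Context {R : realType} {s : scalar_kind}.
Notation K := (scalar_field R s).

Lemma real_partK (x : K) : 0 <= x -> of_real (real_part x) = x.
Proof.
case: s x => //= -[a b]; rewrite lecE /= => /andP[/eqP-> _].
by [].
Qed.

Lemma of_realK (r : R) : real_part (of_real r : K) = r.
Proof. by case: s. Qed.

Lemma of_real_inj : injective (of_real : R -> K).
Proof. exact: can_inj of_realK. Qed.

Lemma of_real_le (x y : R) : (of_real x <= of_real y :> K) = (x <= y).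
Proof. by case: s => //=; rewrite lecR. Qed.

Lemma of_realD (x y : R) : of_real (x + y) = of_real x + of_real y :> K.
Proof. by case: s => //=; rewrite rmorphD. Qed.

Lemma of_realM (x y : R) : of_real (x * y) = of_real x * of_real y :> K.
Proof. by case: s => //=; rewrite rmorphM. Qed.

Lemma of_real0 : of_real 0 = 0 :> K.
Proof. by case: s. Qed.

Lemma real_part1 : real_part (1 : K) = 1.
Proof. by case: s. Qed.

Lemma real_part_le (x y : K) : 0 <= x -> x <= y -> real_part x <= real_part y.
Proof.
move=> x0 xy; rewrite -of_real_le !real_partK //; exact: le_trans xy.
Qed.

End ScalarTheory.

Section RealNorm.
Context {R : realType} {s : scalar_kind}.
Notation K := (scalar_field R s).

Definition rnorm (V : normedModType K) (v : V) : R := real_part `|v|.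

Lemma of_real_rnorm (V : normedModType K) (v : V) : of_real (rnorm v) = `|v|.
Proof. exact/real_partK/normr_ge0. Qed.

Lemma rnorm_ge0 (V : normedModType K) (v : V) : 0 <= rnorm v.
Proof. by rewrite -(@of_real_le R s) of_real_rnorm of_real0. Qed.

Lemma ler_rnorm (V W : normedModType K) (v : V) (w : W) :
  (rnorm v <= rnorm w) = (`|v| <= `|w|).
Proof. by rewrite -(@of_real_le R s) !of_real_rnorm. Qed.

Lemma rnormD (V : normedModType K) (v w : V) :
  rnorm (v + w) <= rnorm v + rnorm w.
Proof. by rewrite -(@of_real_le R s) of_realD !of_real_rnorm ler_normD. Qed.

Lemma rnormZ (V : normedModType K) (a : K) (v : V) :
  rnorm (a *: v) = real_part `|a| * rnorm v.
Proof.
by apply: (@of_real_inj R s); rewrite of_realM !of_real_rnorm normrZ.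
Qed.

Lemma rnorm0 (V : normedModType K) : rnorm (0 : V) = 0.
Proof. by rewrite /rnorm normr0 -(@of_real0 R s) of_realK. Qed.

Lemma rnorm0_eq0 (V : normedModType K) (v : V) : rnorm v = 0 -> v = 0.
Proof.
by move=> v0; apply/normr0_eq0; rewrite -of_real_rnorm v0 of_real0.
Qed.

Definition closed_unit_ball (V : normedModType K) : set V :=
  [set v | `|v| <= 1].

End RealNorm.

Arguments closed_unit_ball {R s} V.

Section BoundedOperators.
Context {R : realType} {s : scalar_kind}.
Notation K := (scalar_field R s).
Variables X Y : normedModType K.

Definition bounded_operator : {pred (X -> Y)} := fun T =>
  `[< linear T /\ exists M : K, forall x, `|T x| <= M * `|x| >].

Record Lop := MkLop { Lop_fun :> X -> Y; LopP : Lop_fun \in bounded_operator }.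

HB.instance Definition _ := [isSub for Lop_fun].
HB.instance Definition _ := [Choice of Lop by <:].

Lemma bounded_operator_submod : submod_closed bounded_operator.
Proof.
split.
  apply/asboolP; split; first by move=> a u v; rewrite scaler0 addr0.
  by exists 0 => x; rewrite normr0 mul0r.
move=> a f g /asboolP[lf [M fM]] /asboolP[lg [N gN]]; apply/asboolP; split.
  move=> b u v; rewrite !fctE /= lf lg.
  by rewrite !scalerDr !scalerA addrACA (mulrC b).
exists (`|a| * M + N) => x; rewrite !fctE /= mulrDl.
apply: (le_trans (ler_normD _ _)); apply: lerD => //.
by rewrite normrZ -mulrA ler_wpM2l.
Qed.

HB.instance Definition _ :=
  GRing.isSubmodClosed.Build _ _ bounded_operator bounded_operator_submod.
HB.instance Definition _ := [SubChoice_isSubLmodule of Lop by <:].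

Lemma Lop_linear (T : Lop) : linear T.
Proof. by have /asboolP[] := LopP T. Qed.

HB.instance Definition _ (T : Lop) :=
  GRing.isLinear.Build K X Y _ (Lop_fun T) (Lop_linear T).

Lemma Lop_bounded (T : Lop) : exists M : K, forall x, `|T x| <= M * `|x|.
Proof. by have /asboolP[] := LopP T. Qed.

Definition opnorm (T : Lop) : R :=
  sup [set rnorm (T x) | x in closed_unit_ball X].

Lemma opnorm_has_sup (T : Lop) :
  has_sup [set rnorm (T x) | x in closed_unit_ball X].
Proof.
split; first by exists (rnorm (T 0)), 0 => //=; rewrite /closed_unit_ball/= normr0.
have [M TM] := Lop_bounded T; exists (real_part `|M|) => _ [x x1 <-].
apply: real_part_le => //.
apply: (le_trans (TM x)); rewrite -[leRHS]mulr1.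
have [->|x0] := eqVneq x 0; first by rewrite normr0 mulr0 mulr1.
have Mge0 : 0 <= M.
  have nx0 : 0 < `|x| by rewrite normr_gt0.
  by have := le_trans (normr_ge0 _) (TM x); rewrite pmulr_lge0.
by rewrite (ger0_norm Mge0); apply: ler_wpM2l.
Qed.

Lemma opnorm_ub (T : Lop) x : `|x| <= 1 -> rnorm (T x) <= opnorm T.
Proof.
move=> x1; apply: ub_le_sup; first by case: (opnorm_has_sup T).
by exists x.
Qed.

Lemma opnorm_le (T : Lop) (c : R) :
  (forall x, `|x| <= 1 -> rnorm (T x) <= c) -> opnorm T <= c.
Proof.
move=> Tc; apply: ge_sup; first by case: (opnorm_has_sup T).
by move=> _ [x x1 <-]; exact: Tc.
Qed.

Lemma opnorm_ge0 (T : Lop) : 0 <= opnorm T.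
Proof.
by apply: le_trans (rnorm_ge0 (T 0)) (opnorm_ub _ _); rewrite normr0.
Qed.

Lemma rnorm_le_opnorm (T : Lop) x : rnorm (T x) <= opnorm T * rnorm x.
Proof.
have [->|x0] := eqVneq x 0; first by rewrite linear0 !rnorm0 mulr0.
have nx0 : 0 < `|x| by rewrite normr_gt0.
have rx0 : 0 < rnorm x.
  by rewrite lt_def rnorm_ge0 andbT; apply: contra_neq x0; exact: rnorm0_eq0.
have := @opnorm_ub T (`|x|^-1 *: x).
rewrite normrZ normfV normr_id mulVf ?gt_eqF// => /(_ (lexx _)).
rewrite linearZ /= rnormZ normfV normr_id.
suff -> : real_part `|x|^-1 = (rnorm x)^-1 by rewrite ler_pdivrMl // mulrC.
apply: (mulIf (lt0r_neq0 rx0)); rewrite mulVf ?gt_eqF//.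
rewrite -[LHS](@of_realK R s) of_realM of_real_rnorm real_partK ?invr_ge0//.
by rewrite mulVf ?gt_eqF// real_part1.
Qed.

Let Lop_norm (T : Lop) : K := of_real (opnorm T).

Let Lop_normD (S T : Lop) : Lop_norm (S + T) <= Lop_norm S + Lop_norm T.
Proof.
rewrite /Lop_norm -of_realD of_real_le; apply: opnorm_le => x x1.
by apply: le_trans (rnormD _ _) _; apply: lerD; exact: opnorm_ub.
Qed.

Let Lop_normZ (a : K) (T : Lop) : Lop_norm (a *: T) = `|a| * Lop_norm T.
Proof.
have le b (S : Lop) : opnorm (b *: S) <= real_part `|b| * opnorm S.
  apply: opnorm_le => x x1; rewrite rnormZ; apply: ler_wpM2l.
    by rewrite -(@of_real_le R s) real_partK // of_real0.
  exact: opnorm_ub.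
have {1}<- : of_real (real_part `|a|) = `|a| by exact: real_partK.
rewrite /Lop_norm -of_realM; congr of_real; apply/eqP; rewrite eq_le le /=.
have [->|a0] := eqVneq a 0.
  by rewrite scale0r normr0 -(@of_real0 R s) of_realK mul0r opnorm_ge0.
have := le a^-1 (a *: T); rewrite scalerA mulVf // scale1r.
have a'0 : 0 < real_part `|a|.
  rewrite lt_def -(@of_real_le R s) real_partK // of_real0 normr_ge0 andbT.
  apply: contra_neq a0 => a0; apply/normr0_eq0.
  by rewrite -(@real_partK R s `|a|) // a0 of_real0.
suff -> : real_part `|a^-1| = (real_part `|a|)^-1.
  by rewrite -ler_pdivlMl ?invr_gt0 // invrK.
apply: (mulIf (lt0r_neq0 a'0)); rewrite mulVf ?gt_eqF//.
rewrite -[LHS](@of_realK R s) of_realM !real_partK //.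
by rewrite normfV mulVf ?normr_eq0 // real_part1.
Qed.

Let Lop_norm0_eq0 (T : Lop) : Lop_norm T = 0 -> T = 0.
Proof.
move=> T0; apply/val_inj/funext => x /=; apply: rnorm0_eq0.
have o0 : opnorm T = 0.
  by apply/eqP; rewrite eq_le opnorm_ge0 andbT -(@of_real_le R s) of_real0 -T0.
apply/eqP; rewrite eq_le rnorm_ge0 andbT.
by have := rnorm_le_opnorm T x; rewrite o0 mul0r.
Qed.

HB.instance Definition _ :=
  Lmodule_isNormed.Build K Lop Lop_normD Lop_normZ Lop_norm0_eq0.

Lemma Lop_normE (T : Lop) : `|T| = of_real (opnorm T).
Proof. by []. Qed.

Lemma rnorm_Lop (T : Lop) : rnorm T = opnorm T.
Proof. by rewrite /rnorm Lop_normE of_realK. Qed.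

Lemma Lop_norm_le (T : Lop) x : `|T x| <= `|T| * `|x|.
Proof.
rewrite Lop_normE -(of_real_rnorm (T x)) -(of_real_rnorm x) -of_realM.
by rewrite of_real_le rnorm_le_opnorm.
Qed.

End BoundedOperators.

Arguments Lop {R s} X Y.
Arguments bounded_operator {R s} X Y.

Notation dual_space X := (Lop X ((scalar_field _ _)^o : normedModType _)).

Section Adjoint.
Context {R : realType} {s : scalar_kind}.
Notation K := (scalar_field R s).
Variables (X Y : normedModType K) (T : Lop X Y).

Lemma adjoint_fun_subproof (f : dual_space Y) :
  (f \o T : X -> K^o) \in bounded_operator X K^o.
Proof.
apply/asboolP; split; first by move=> a u v /=; rewrite !linearP.
exists (`|f| * `|T|) => x /=; apply: (le_trans (Lop_norm_le _ _)).
by rewrite -mulrA ler_wpM2l // Lop_norm_le.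
Qed.

Definition adjoint_fun (f : dual_space Y) : dual_space X :=
  MkLop (adjoint_fun_subproof f).

Lemma adjoint_subproof :
  adjoint_fun \in bounded_operator (dual_space Y) (dual_space X).
Proof.
apply/asboolP; split; first by move=> a f g; exact/val_inj.
exists `|T| => f; rewrite Lop_normE -(of_real_rnorm f) Lop_normE -of_realM.
rewrite of_real_le; apply: opnorm_le => x x1 /=.
rewrite mulrC; apply: (le_trans (rnorm_le_opnorm _ _)).
rewrite rnorm_Lop ler_wpM2l ?opnorm_ge0 //; exact: opnorm_ub.
Qed.

Definition adjoint : Lop (dual_space Y) (dual_space X) := MkLop adjoint_subproof.

Lemma adjointE (f : dual_space Y) x : adjoint f x = f (T x).
Proof. by []. Qed.

End Adjoint.

Section WeakConvergence.
Context {R : realType} {s : scalar_kind}.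
Notation K := (scalar_field R s).
Variables (X : normedModType K) (I : Type) (F : set_system I).

Definition weakly_null (u : I -> X) : Prop :=
  forall f : dual_space X, f (u i) @[i --> F] --> (0 : K^o).

Definition weakly_star_null (f : I -> dual_space X) : Prop :=
  forall x : X, f i x @[i --> F] --> (0 : K^o).

End WeakConvergence.

Definition reflexive_space {R : realType} {s : scalar_kind}
    (X : normedModType (scalar_field R s)) : Prop :=
  forall phi : dual_space (dual_space X), exists x : X,
    forall f : dual_space X, phi f = f x.

(* Same formula as [limf_esup], without a topology on the index type. *)
Definition limsup_along {R : realType} (I : Type) (F : set_system I)
    (r : I -> R) : \bar R :=
  ereal_inf [set ereal_sup [set (r i)%:E | i in A] | A in F].

Record directed (I : Type) (le : I -> I -> Prop) : Prop := Directed {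
  directed_inhabited : inhabited I;
  directed_refl : forall a, le a a;
  directed_trans : forall a b c, le a b -> le b c -> le a c;
  directed_ub : forall a b, exists c, le a c /\ le b c }.

Definition tails (I : Type) (le : I -> I -> Prop) : set_system I :=
  filter_from [set: I] (fun a => [set b | le a b]).

Lemma tails_proper (I : Type) (le : I -> I -> Prop) :
  directed le -> ProperFilter (tails le).
Proof.
case=> -[i0] le_refl le_trans le_ub; apply: filter_from_proper => [|a _].
  apply: filter_from_filter; first by exists i0.
  move=> a b _ _; have [c [ac bc]] := le_ub a b; exists c => // d cd.
  by split; apply: (le_trans _ c).
by exists a; exact: le_refl.
Qed.

Section Properties.
Context {R : realType} {s : scalar_kind}.
Notation K := (scalar_field R s).
Variables X Y : normedModType K.

Definition contraction (T : Lop X Y) : Prop := `|T| <= 1.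

Definition limsup_adjoint_lt (T : Lop X Y) (g : dual_space Y)
    (I : Type) (F : set_system I) (f : I -> dual_space Y) : Prop :=
  (limsup_along F (fun i => rnorm (adjoint T (f i))) <
   limsup_along F (fun i => rnorm (g + f i)%R))%E.

Definition operator_sOstar (T : Lop X Y) : Prop :=
  forall g : dual_space Y, g <> 0 ->
  forall (I : Type) (le : I -> I -> Prop), directed le ->
  forall f : I -> dual_space Y, bounded_set (range f) ->
    weakly_star_null (tails le) f -> limsup_adjoint_lt T g (tails le) f.

(* No boundedness hypothesis: weakly* null sequences in the dual of a Banach
   space are bounded. *)
Definition operator_Ostar (T : Lop X Y) : Prop :=
  forall g : dual_space Y, g <> 0 ->
  forall f : nat -> dual_space Y,
    weakly_star_null \oo f -> limsup_adjoint_lt T g \oo f.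

Definition property_sOstar : Prop :=
  forall T : Lop X Y, contraction T -> operator_sOstar T.

Definition property_Ostar : Prop :=
  forall T : Lop X Y, contraction T -> operator_Ostar T.

Definition attains_norm (T : Lop X Y) : Prop :=
  exists x : X, `|x| = 1 /\ `|T x| = `|T|.

Definition maximizing_sequence (T : Lop X Y) (u : nat -> X) : Prop :=
  (forall n, closed_unit_ball X (u n)) /\ `|T (u n)| @[n --> \oo] --> `|T|.

Definition WMP : Prop :=
  forall T : Lop X Y,
    (exists u, maximizing_sequence T u /\ ~ weakly_null \oo u) ->
    attains_norm T.

End Properties.

(* This is the property of the pair (dual_space Y, dual_space X): only adjoints
   of operators from X to Y are tested. *)
Definition weak_star_to_weak_star_MP {R : realType} {s : scalar_kind}
    (X Y : normedModType (scalar_field R s)) : Prop :=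
  forall T : Lop X Y,
    (exists u, maximizing_sequence (adjoint T) u /\ ~ weakly_star_null \oo u) ->
    attains_norm (adjoint T).

(* Main.v *)
Require Import Defs.
From mathcomp Require Import all_boot all_order all_algebra.
From mathcomp Require Import complex.
From mathcomp Require Import all_classical all_reals all_analysis.
From mathcomp Require Import ring lra.

Set Implicit Arguments.
Unset Strict Implicit.
Unset Printing Implicit Defensive.

Import Order.TTheory GRing.Theory Num.Theory.
Import numFieldNormedType.Exports.

Local Open Scope classical_set_scope.
Local Open Scope ring_scope.

(** The proof turns a maximizing sequence of the adjoint into one of [T] itself, so that the
    WMP applies to [T].

    Let [T] have norm [t > 0], and let [u_n] be functionals of norm at most 1 with
    [|T* u_n| --> t] that are not weakly* null.  By compactness of the dual ball some subnet
    [u_nu(i)] converges weakly* to a functional [g <> 0].  Choose [x_n] in the unit ball with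
    [|u_n (T x_n)|] close to [|T* u_n|]; then [|T x_n| --> t], so [x_n] is maximizing for [T].
    If it were weakly null, [g (T x_nu(i))] would tend to 0, hence
    [|T* (u_nu(i) - g)| >= |(u_nu(i) - g) (T x_nu(i))|] would have limit superior at least [t].
    But the hypothesis on the contraction [T / t], tested at [g] and the weakly* null net
    [u_nu(i) - g], says that this limit superior is less than
    [t * limsup |g + (u_nu(i) - g)| <= t] ([limsup_adjoint_lt_not_weakly_null]).  So [x_n] is not
    weakly null, [T] attains its norm at some [x] by the WMP, and a functional norming [T x]
    shows that [T*] attains its norm ([adjoint_attains_norm]).  If [t = 0], every unit vector
    will do, and [g / |g|] is one.

    For property sO* the subnet comes from an ultrafilter ([banach_alaoglu],
    [ultrafilter_net]).  For property O* the net must be a sequence, and reflexivity of [Y]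
    provides it ([eberlein]): by Hahn-Banach, all weak* limits of the [u_n] lie in their closed
    span, where countably many vectors of [Y] separate points, so a subsequence that converges
    on these vectors has only one weak* cluster point.

    Everything rests on the Hahn-Banach theorem, for real and complex scalars at once
    ([hahn_banach]): a seminorm [p] dominates a linear functional whose value at a given vector
    is as large as [p] permits.  It follows from the fact that a minimal sublinear function is
    real linear. *)

(** * Real and complex scalars *)

Section Scalars.
Context {R : realType} {s : scalar_kind}.
Notation K := (scalar_field R s).

(** The modulus is taken in [R] rather than in the scalar field, so that suprema and linear
    arithmetic apply to it. *)
Definition modulus (z : K) : R := real_part `|z|.

Lemma of_real_modulus (z : K) : of_real (modulus z) = `|z|.
Proof. exact/real_partK/normr_ge0. Qed.

Lemma of_real_lt (x y : R) : (of_real x < of_real y :> K) = (x < y).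
Proof. by rewrite !lt_neqAle of_real_le (inj_eq (@of_real_inj R s)). Qed.

Lemma modulus_ge0 z : 0 <= modulus z.
Proof. by rewrite -(@of_real_le R s) of_real_modulus of_real0. Qed.

Lemma modulusD a b : modulus (a + b) <= modulus a + modulus b.
Proof. by rewrite -(@of_real_le R s) of_realD !of_real_modulus ler_normD. Qed.

Lemma modulusM a b : modulus (a * b) = modulus a * modulus b.
Proof.
by apply: (@of_real_inj R s); rewrite of_realM !of_real_modulus normrM.
Qed.

Lemma modulusN a : modulus (- a) = modulus a.
Proof. by rewrite /modulus normrN. Qed.

Lemma modulus_dist_le (c a b : K) :
  modulus (a - b) <= modulus (c - a) + modulus (c - b).
Proof.
have -> : a - b = (c - b) - (c - a) by ring.
by rewrite [leRHS]addrC (le_trans (modulusD _ _)) // modulusN.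
Qed.

Lemma modulus_le_dist (b a : K) : modulus a <= modulus b + modulus (b - a).
Proof.
have -> : modulus a = modulus (b - (b - a)) by congr modulus; ring.
by rewrite (le_trans (modulusD _ _)) // modulusN.
Qed.

Lemma modulus0 : modulus 0 = 0.
Proof. by rewrite /modulus normr0 -(@of_real0 R s) of_realK. Qed.

Lemma modulus1 : modulus 1 = 1.
Proof. by rewrite /modulus normr1 real_part1. Qed.

Lemma modulus0_eq0 a : modulus a = 0 -> a = 0.
Proof. by move=> a0; apply/normr0_eq0; rewrite -of_real_modulus a0 of_real0. Qed.

Lemma modulus_of_real (r : R) : modulus (of_real r) = `|r|.
Proof.
apply: (@of_real_inj R s); rewrite of_real_modulus.
by case: s => //=; rewrite normc_def /= expr0n addr0 sqrtr_sqr.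
Qed.

Lemma real_part_ge (z : K) : real_part z <= modulus z.
Proof.
rewrite /modulus; case: s z => [z|[a b]] /=; first exact: ler_norm.
by rewrite (le_trans (ler_norm _))// -sqrtr_sqr ler_wsqrtr // lerDl sqr_ge0.
Qed.

Lemma real_part_norm (z : K) : `|real_part z| <= modulus z.
Proof.
rewrite ler_norml real_part_ge andbT lerNl -modulusN.
apply: le_trans (real_part_ge _).
by case: s z => [z|[z1 z2]] /=.
Qed.

(** Taking 0 for the imaginary unit of the real field lets the formulas that express a complex
    number, or a complex linear functional, through real parts hold for both fields. *)
Definition imag_unit : K :=
  match s return scalar_field R s with
  | RealScalars => 0
  | ComplexScalars => ('i)%C
  end.

Lemma modulus_imag_unit : modulus imag_unit <= 1.
Proof.
rewrite /modulus /imag_unit; case: s => /=; first by rewrite normr0.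
by rewrite expr0n expr1n add0r sqrtr1.
Qed.

Lemma real_partD (a b : K) : real_part (a + b) = real_part a + real_part b.
Proof. by case: s a b => [a b|[? ?] [? ?]]. Qed.

Lemma real_partN (a : K) : real_part (- a) = - real_part a.
Proof. by case: s a => [a|[? ?]]. Qed.

Lemma real_partZ (r : R) (a : K) : real_part (of_real r * a) = r * real_part a.
Proof. by case: s a => [a|[? ?]] //=; rewrite mul0r subr0. Qed.

Lemma of_real1 : of_real 1 = 1 :> K.
Proof. by case: s. Qed.

Lemma of_realN (r : R) : of_real (- r) = - of_real r :> K.
Proof. by apply/eqP; rewrite -addr_eq0 -of_realD addNr of_real0. Qed.

(** [z = Re z - i Re (i z)]: the second term vanishes for real scalars. *)
Lemma scalar_decomp (z : K) :
  z = of_real (real_part z) - imag_unit * of_real (real_part (imag_unit * z)).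
Proof.
rewrite /imag_unit; case: s z => [z|[a b]] /=; first by rewrite mul0r subr0.
by apply/eqP; rewrite eq_complex /=; apply/andP; split; apply/eqP; ring.
Qed.

Lemma real_part_imag (r : R) : real_part (imag_unit * of_real r : K) = 0.
Proof. by rewrite mulrC real_partZ /imag_unit; case: s => /=; rewrite mulr0. Qed.

Lemma imag_unit_cases : imag_unit = 0 \/ imag_unit * imag_unit = -1.
Proof.
by rewrite /imag_unit; case: s => /=; [left|right; rewrite -expr2 sqr_i].
Qed.

Lemma unimodular_factor (z : K) :
  exists2 a : K, modulus a <= 1 & a * z = of_real (modulus z).
Proof.
exists (`|z| / z); last first.
  have [->|z0] := eqVneq z 0; first by rewrite mulr0 modulus0 of_real0.
  by rewrite divfK // of_real_modulus.
rewrite -(@real_part1 R s) /modulus real_part_le // normrM normfV normr_id.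
have [->|z0] := eqVneq z 0; first by rewrite normr0 mul0r.
by rewrite mulfV // normr_eq0.
Qed.

Lemma countable_dense_scalars :
  exists c : nat -> K, forall a (e : R), 0 < e -> exists m, modulus (a - c m) < e.
Proof.
have approx (r e : R) : 0 < e -> exists q : rat, `|r - ratr q| < e.
  move=> e0; have : r - e < r + e by lra.
  case/rat_in_itvoo => q; rewrite in_itv /= => /andP[q1 q2]; exists q.
  by rewrite ltr_norml; apply/andP; split; lra.
pose c (q : rat * rat) : K :=
  of_real (ratr q.1) - imag_unit * of_real (ratr q.2).
exists (fun m => odflt 0 (omap c (unpickle m))) => a e e0.
have e20 : 0 < e / 2 by rewrite divr_gt0.
have [q1 q1P] := approx (real_part a) _ e20.
have [q2 q2P] := approx (real_part (imag_unit * a)) _ e20.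
exists (pickle (q1, q2)); rewrite pickleK /= /c /= [in modulus _](scalar_decomp a).
set A := real_part a; set B := real_part _.
have -> : of_real A - imag_unit * of_real B -
    (of_real (ratr q1) - imag_unit * of_real (ratr q2)) =
    of_real (A - ratr q1) - imag_unit * of_real (B - ratr q2) :> K.
  by rewrite !of_realD !of_realN; ring.
apply: le_lt_trans (modulusD _ _) _; rewrite modulusN modulusM !modulus_of_real.
have := modulus_imag_unit; have := normr_ge0 (B - ratr q2).
move: q1P q2P; rewrite -/A -/B; nra.
Qed.

End Scalars.

(** * The Hahn-Banach theorem *)

Section Sublinear.
Context {R : realType} {s : scalar_kind}.
Notation K := (scalar_field R s).
Variable V : lmodType K.
Implicit Types (p q : V -> R) (x y v : V).

Definition sublinear p : Prop :=
  (forall x y, p (x + y) <= p x + p y) /\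
  (forall r x, 0 <= r -> p (of_real r *: x) <= r * p x).

Lemma sublinear_scale p r x : sublinear p -> 0 <= r -> p (of_real r *: x) = r * p x.
Proof.
move=> [pD pZ] r0; apply/eqP; rewrite eq_le pZ //=.
have [->|rn0] := eqVneq r 0.
  rewrite mul0r of_real0 scale0r.
  by have := pD 0 0; rewrite addr0; lra.
have := pZ r^-1 (of_real r *: x); rewrite scalerA -of_realM mulVf //.
rewrite of_real1 scale1r invr_ge0 => /(_ r0).
by rewrite ler_pdivlMl // lt_def rn0.
Qed.

Lemma sublinear0 p : sublinear p -> p 0 = 0.
Proof.
by move=> /(@sublinear_scale _ 0 0) /(_ (lexx _)); rewrite scaler0 mul0r.
Qed.

Lemma sublinear_oppr p x : sublinear p -> - p (- x) <= p x.
Proof.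
move=> ps; have := ps.1 x (- x); rewrite subrr sublinear0 //; lra.
Qed.

(** The infimal convolution of [p] with the linear map [t v |-> t p v] on the half-line opposite
    to [v].  It is the largest sublinear function below [p] for which every linear
    [u] below it satisfies [u v >= p v]. *)
Definition tilt p v x : R :=
  inf [set p (x + of_real t *: v) - t * p v | t in [set t | 0 <= t]].

(** The lower bound comes from [t p v = p (t v) <= p (x + t v) + p (- x)]. *)
Lemma tilt_has_inf p v x : sublinear p ->
  has_inf [set p (x + of_real t *: v) - t * p v | t in [set t | 0 <= t]].
Proof.
move=> ps; split; first by exists (p (x + of_real 0 *: v) - 0 * p v), 0 => //=.
exists (- p (- x)) => _ [t /= t0 <-].
rewrite -(sublinear_scale v ps t0).
have := ps.1 (x + of_real t *: v) (- x); rewrite addrC addKr; lra.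
Qed.

Lemma tilt_le p v x t : sublinear p -> 0 <= t ->
  tilt p v x <= p (x + of_real t *: v) - t * p v.
Proof.
by move=> ps t0; apply: ge_inf; [case: (tilt_has_inf v x ps)|exists t].
Qed.

Lemma le_tilt p v x c : sublinear p ->
  (forall t, 0 <= t -> c <= p (x + of_real t *: v) - t * p v) -> c <= tilt p v x.
Proof.
move=> ps cle; apply: lb_le_inf; first by case: (tilt_has_inf v x ps).
by move=> _ [t t0 <-]; exact: cle.
Qed.

Lemma tilt_le_id p v x : sublinear p -> tilt p v x <= p x.
Proof.
move=> ps; apply: le_trans (tilt_le v x ps (lexx 0)) _.
by rewrite of_real0 scale0r addr0 mul0r subr0.
Qed.

Lemma tilt_sublinear p v : sublinear p -> sublinear (tilt p v).
Proof.
move=> ps; split=> [x y|r x r0].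
  rewrite -lerBlDr; apply: le_tilt => // t t0.
  rewrite lerBlDr -lerBlDl; apply: le_tilt => // t' t'0.
  rewrite lerBlDl.
  apply: le_trans (tilt_le v (x + y) ps (addr_ge0 t0 t'0)) _.
  rewrite of_realD scalerDl addrACA.
  have := ps.1 (x + of_real t *: v) (y + of_real t' *: v); lra.
have [->|rn0] := eqVneq r 0.
  rewrite of_real0 scale0r mul0r (le_trans (tilt_le_id _ _ ps)) //.
  by rewrite sublinear0.
have rp : 0 < r by rewrite lt_def rn0.
rewrite -ler_pdivrMl //; apply: le_tilt => // t t0; rewrite ler_pdivrMl //.
apply: le_trans (tilt_le _ _ ps (mulr_ge0 r0 t0)) _.
by rewrite of_realM -scalerA -scalerDr sublinear_scale // mulrBr mulrA.
Qed.

(** Subadditivity survives the infimum because any two members of a chain have a common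
    lower one. *)
Lemma chain_inf_sublinear p (A : set (V -> R)) :
  A !=set0 -> (forall a, A a -> sublinear a /\ forall x, a x <= p x) ->
  (forall a b, A a -> A b -> (forall x, a x <= b x) \/ (forall x, b x <= a x)) ->
  [/\ sublinear (fun x => inf [set a x | a in A]),
      forall x, inf [set a x | a in A] <= p x &
      forall a x, A a -> inf [set b x | b in A] <= a x].
Proof.
move=> [a0 Aa0] Ap Atot.
have Ainf x : has_inf [set a x | a in A].
  split; first by exists (a0 x), a0.
  exists (- p (- x)) => _ [a /Ap[as_ ap] <-].
  by apply: le_trans (sublinear_oppr x as_); rewrite lerN2.
have inf_le a x : A a -> inf [set b x | b in A] <= a x.
  by move=> Aa; apply: ge_inf; [case: (Ainf x)|exists a].
have le_inf c x : (forall a, A a -> c <= a x) -> c <= inf [set b x | b in A].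
  move=> cle; apply: lb_le_inf; first by case: (Ainf x).
  by move=> _ [a Aa <-]; exact: cle.
split=> //; last by move=> x; apply: le_trans (inf_le _ _ Aa0) _; case: (Ap _ Aa0).
split=> [x y|r x r0].
  rewrite -lerBlDr; apply: (le_inf _ x) => a Aa.
  rewrite lerBlDr -lerBlDl; apply: (le_inf _ y) => b Ab; rewrite lerBlDl.
  have [ab|ba] := Atot _ _ Aa Ab.
    apply: le_trans (inf_le _ _ Aa) _; have [[aD _] _] := Ap _ Aa.
    by apply: le_trans (aD _ _) _; rewrite lerD2l.
  apply: le_trans (inf_le _ _ Ab) _; have [[bD _] _] := Ap _ Ab.
  by apply: le_trans (bD _ _) _; rewrite lerD2r.
have [rn0|rn0] := eqVneq r 0.
  apply: le_trans (inf_le _ _ Aa0) _; have [[_ aZ] _] := Ap _ Aa0.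
  by apply: le_trans (aZ _ _ r0) _; rewrite rn0 !mul0r.
have rp : 0 < r by rewrite lt_def rn0.
rewrite -ler_pdivrMl //; apply: (le_inf _ x) => a Aa; rewrite ler_pdivrMl //.
apply: le_trans (inf_le _ _ Aa) _; have [[_ aZ] _] := Ap _ Aa.
exact: aZ.
Qed.

Lemma minimal_sublinear p : sublinear p ->
  exists q, [/\ sublinear q, forall x, q x <= p x &
    forall q', sublinear q' -> (forall x, q' x <= q x) -> q' = q].
Proof.
move=> ps; pose T := {q : V -> R | sublinear q /\ forall x, q x <= p x}.
pose le (q1 q2 : T) := `[< forall x, sval q2 x <= sval q1 x >].
have [|||A Atot|[q [qs qp]] qmin] := @Zorn T le.
- by move=> q; apply/asboolP.
- move=> q1 q2 q3 /asboolP q21 /asboolP q32; apply/asboolP => x.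
  exact: le_trans (q32 x) (q21 x).
- move=> [q1 q1P] [q2 q2P] /asboolP /= q21 /asboolP /= q12; apply: eq_exist.
  by apply/funext => x; apply/eqP; rewrite eq_le q12 q21.
- have [->|A0] := eqVneq A set0.
    by exists (exist _ p (conj ps (fun x => lexx _))).
  have /set0P[a0 Aa0] := A0.
  pose B := [set sval q | q in A].
  have [||a b [q1 Aq1 <-] [q2 Aq2 <-]|infs infp inf_le] := @chain_inf_sublinear p B.
  + by exists (sval a0), a0.
  + by move=> _ [[q qP] _ <-].
  + by have [/asboolP|/asboolP] := Atot _ _ Aq1 Aq2; [right|left].
  exists (exist (fun q => sublinear q /\ forall x, q x <= p x) _ (conj infs infp)).
  move=> q Aq; apply/asboolP => x /=.
  by apply: inf_le; exists q.
exists q; split=> // q' q's q'q.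
have q'p x : q' x <= p x by exact: le_trans (q'q x) (qp x).
by have /(congr1 sval) := qmin (exist _ q' (conj q's q'p)) (asboolT q'q).
Qed.

Definition real_linear (u : V -> R) : Prop :=
  (forall x y, u (x + y) = u x + u y) /\
  (forall r x, u (of_real r *: x) = r * u x).

(** Minimality gives [tilt q y = q] for every [y], and the member [t = 1] of the infimum
    then reads [q x <= q (x + y) - q y], the missing half of additivity. *)
Lemma minimal_sublinear_real_linear q : sublinear q ->
  (forall q', sublinear q' -> (forall x, q' x <= q x) -> q' = q) -> real_linear q.
Proof.
move=> qs qmin.
have qD x y : q (x + y) = q x + q y.
  apply/eqP; rewrite eq_le qs.1 /=.
  have E : tilt q y = q.
    by apply: qmin; [exact: tilt_sublinear|move=> z; exact: tilt_le_id].
  have := tilt_le y x qs ler01; rewrite E.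
  by rewrite of_real1 scale1r mul1r; lra.
have qN x : q (- x) = - q x.
  by apply/eqP; rewrite -addr_eq0 -qD addNr sublinear0.
split=> // r x; have [r0|/ltW r0] := leP 0 r; first exact: sublinear_scale.
have -> : of_real r *: x = - (of_real (- r) *: x).
  by rewrite of_realN scaleNr opprK.
by rewrite qN sublinear_scale ?oppr_ge0 // mulNr opprK.
Qed.

(** A minimal sublinear function below [tilt p v] is linear, and its value at [- v] is at most
    [tilt p v (- v) <= - p v]. *)
Lemma real_hahn_banach p v : sublinear p ->
  exists u, [/\ real_linear u, forall x, u x <= p x & p v <= u v].
Proof.
move=> ps; have ts := tilt_sublinear v ps.
have [u [us ut umin]] := minimal_sublinear ts.
have uL := minimal_sublinear_real_linear us umin.
exists u; split=> // [x|]; first exact: le_trans (ut x) (tilt_le_id v x ps).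
have := le_trans (ut (- v)) (tilt_le v (- v) ps ler01).
rewrite of_real1 scale1r addNr sublinear0 // mul1r sub0r.
have := uL.1 v (- v); rewrite subrr sublinear0 //; lra.
Qed.

Definition seminorm p : Prop :=
  (forall x y, p (x + y) <= p x + p y) /\
  (forall (a : K) x, p (a *: x) <= modulus a * p x).

Lemma seminormB_le0 p x y : seminorm p -> p x <= 0 -> p y <= 0 -> p (x - y) <= 0.
Proof.
move=> [pD pZ] px py; apply: le_trans (pD _ _) _.
have := pZ (-1) y; rewrite scaleN1r modulusN modulus1; lra.
Qed.

(** The complex linear functional whose real part is [u]; for real scalars it is [u]. *)
Definition complexify (u : V -> R) x : K :=
  of_real (u x) - imag_unit * of_real (u (imag_unit *: x)).

Lemma real_part_complexify u x : real_linear u -> real_part (complexify u x) = u x.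
Proof.
move=> uL; rewrite /complexify real_partD of_realK real_partN.
by rewrite real_part_imag subr0.
Qed.

(** Over the complex field, [i (u x - i u (i x)) = u (i x) - i u (i (i x))] since
    [u (i (i x)) = - u x]. *)
Lemma complexify_linear u : real_linear u -> linear (complexify u : V -> K^o).
Proof.
move=> [uD uZ].
have cD x y : complexify u (x + y) = complexify u x + complexify u y.
  by rewrite /complexify scalerDr !uD !of_realD; ring.
have cZ r x : complexify u (of_real r *: x) = of_real r * complexify u x.
  by rewrite /complexify scalerA [_ * of_real r]mulrC -scalerA !uZ !of_realM; ring.
have uN x : u (- x) = - u x.
  apply/eqP; rewrite -addr_eq0 -uD addNr.
  by have := uD 0 0; rewrite addr0; lra.
have ci x : complexify u (imag_unit *: x) = imag_unit * complexify u x.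
  have u0 : u 0 = 0 by have := uD 0 0; rewrite addr0; lra.
  rewrite /complexify scalerA.
  have [->|ii] := @imag_unit_cases R s.
    by rewrite !(mul0r, scale0r) u0 of_real0 subr0.
  by rewrite mulrBr mulrA ii scaleN1r uN of_realN; ring.
have cN x : complexify u (- x) = - complexify u x.
  apply/eqP; rewrite -addr_eq0 -cD addNr.
  by rewrite -(scale0r 0) -(of_real0 (s := s)) cZ of_real0 mul0r.
move=> a x y; rewrite cD; congr (_ + _).
rewrite [in LHS](scalar_decomp a) [in RHS](scalar_decomp a) scalerBl cD cN.
rewrite cZ -scalerA ci cZ.
by rewrite /GRing.scale /= mulrBl mulrA.
Qed.

(** Multiplying [x] by a scalar of modulus at most 1 makes the value of the functional
    nonnegative, hence equal to its real part, which [p] bounds. *)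
Lemma modulus_complexify_le p u x : seminorm p -> real_linear u ->
  (forall y, u y <= p y) -> modulus (complexify u x) <= p x.
Proof.
move=> [_ pZ] uL up.
have [a a1 aE] := unimodular_factor (complexify u x).
rewrite -[leLHS](@of_realK R s) -aE.
have -> : a * complexify u x = complexify u (a *: x).
  have L := complexify_linear uL.
  have u0 : u 0 = 0 by rewrite -(scale0r (0 : V)) -(@of_real0 R s) uL.2 mul0r.
  have c0 : complexify u 0 = 0.
    by rewrite /complexify scaler0 u0 of_real0 mulr0 subr0.
  by have := L a x 0; rewrite c0 !addr0 => ->.
rewrite real_part_complexify //; apply: le_trans (up _) _.
apply: le_trans (pZ _ _) _.
have p0 : 0 <= p x.
  have := up x; have := up (- x); have := pZ (-1) x.
  rewrite scaleN1r modulusN modulus1.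
  have := uL.1 x (- x); have := uL.2 0 0; rewrite subrr scaler0 mul0r; lra.
by rewrite ler_piMl.
Qed.

End Sublinear.

Section HahnBanach.
Context {R : realType} {s : scalar_kind}.
Notation K := (scalar_field R s).

(** Stated for one vector and an arbitrary seminorm below the norm: with the norm it yields
    norming functionals, with the distance to a subspace it separates points from this
    subspace. *)
Lemma hahn_banach (V : normedModType K) (p : V -> R) (v : V) :
  seminorm p -> (forall x, p x <= rnorm x) ->
  exists2 f : dual_space V,
    (forall x, modulus (f x) <= p x) & p v <= modulus (f v).
Proof.
move=> pS p1.
have ps : sublinear p.
  split=> [|r x r0]; first exact: pS.1.
  by apply: le_trans (pS.2 _ _) _; rewrite modulus_of_real ger0_norm.
have [u [uL up uv]] := real_hahn_banach v ps.
have fP : (complexify u : V -> K^o) \in bounded_operator V K^o.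
  apply/asboolP; split; first exact: complexify_linear.
  exists 1 => x; rewrite mul1r -!of_real_rnorm of_real_le.
  exact: le_trans (modulus_complexify_le x pS uL up) (p1 x).
exists (MkLop fP) => [x|] /=; first exact: modulus_complexify_le.
by apply: le_trans uv _; rewrite -(real_part_complexify v uL) real_part_ge.
Qed.

End HahnBanach.

(** * Weak* limits along ultrafilters *)

Section WeakStarLimits.
Context {R : realType} {s : scalar_kind}.
Notation K := (scalar_field R s).

Lemma cvg_modulusP (I : Type) (F : set_system I) (f : I -> K^o) (l : K^o) :
  Filter F ->
  (f i @[i --> F] --> l) <->
  (forall e : R, 0 < e -> \forall i \near F, modulus (f i - l : K) < e).
Proof.
move=> FF; split=> [/cvgrPdist_lt fl e e0|fl].
  have e0' : 0 < of_real e :> K by rewrite -(@of_real0 R s) of_real_lt.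
  near=> i; rewrite -modulusN opprB.
  by rewrite -(@of_real_lt R s) of_real_modulus; near: i; exact: fl.
apply/cvgrPdist_lt => e e0.
have eE : of_real (real_part e) = e :> K by rewrite real_partK // ltW.
have e0' : 0 < real_part e by rewrite -(@of_real_lt R s) eE of_real0.
near=> i; rewrite -eE -normrN opprB.
change (`|f i - l : K| < of_real (real_part e)).
by rewrite -of_real_modulus of_real_lt; near: i; exact: fl.
Unshelve. all: by end_near. Qed.

Lemma ultra_bounded_real (I : Type) (U : set_system I) (r : I -> R) (M : R) :
  UltraFilter U -> (forall i, `|r i| <= M) ->
  exists l, forall e : R, 0 < e -> \forall i \near U, `|r i - l| < e.
Proof.
move=> UU rM.
have FU : ProperFilter (r i @[i --> U]) by exact: fmap_proper_filter.
have [|l [_ cl]] := @segment_compact R (- M) M (r i @[i --> U]) FU.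
  by apply: (@filterE _ U) => i /=; rewrite in_itv /= -ler_norml.
exists l => e e0; have [//|ne] := in_ultra_setVsetC [set i | `|r i - l| < e] UU.
have [|x [nx bx]] := cl [set x | ~ `|x - l| < e] (ball l e) _ (nbhsx_ballx l e e0).
  exact: ne.
by exfalso; apply: nx; rewrite distrC; exact: bx.
Qed.

(** The real and imaginary parts converge in a segment, by compactness. *)
Lemma ultra_bounded_scalar (I : Type) (U : set_system I) (z : I -> K) (M : R) :
  UltraFilter U -> (forall i, modulus (z i) <= M) ->
  exists l, forall e : R, 0 < e -> \forall i \near U, modulus (z i - l) < e.
Proof.
move=> UU zM.
have [|a aP] := @ultra_bounded_real I U (fun i => real_part (z i)) M UU.
  by move=> i; exact: le_trans (real_part_norm _) (zM i).
have [|b bP] := @ultra_bounded_real I U (fun i => real_part (imag_unit * z i)) M UU.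
  move=> i; apply: le_trans (real_part_norm _) _; rewrite modulusM.
  apply: le_trans (zM i); rewrite ler_piMl ?modulus_ge0 //.
  exact: modulus_imag_unit.
exists (of_real a - imag_unit * of_real b) => e e0.
have e20 : 0 < e / 2 by rewrite divr_gt0.
near=> i.
rewrite [in modulus _](scalar_decomp (z i)).
have A : `|real_part (z i) - a| < e / 2 by near: i; exact: aP.
have B : `|real_part (imag_unit * z i) - b| < e / 2 by near: i; exact: bP.
set x := real_part (z i) in A *; set y := real_part _ in B *.
have -> : of_real x - imag_unit * of_real y - (of_real a - imag_unit * of_real b)
    = of_real (x - a) - imag_unit * of_real (y - b) :> K.
  by rewrite !of_realD !of_realN; ring.
apply: le_lt_trans (modulusD _ _) _; rewrite modulusN modulusM !modulus_of_real.
have := @modulus_imag_unit R s; have := normr_ge0 (y - b); nra.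
Unshelve. all: by end_near. Qed.

(** Weak* convergence with real error bounds; [weak_star_lim_sub] relates it to weakly* null
    families. *)
Definition weak_star_lim (V : normedModType K) (I : Type) (F : set_system I)
    (u : I -> dual_space V) (g : dual_space V) : Prop :=
  forall x (e : R), 0 < e -> \forall i \near F, modulus (u i x - g x : K) < e.

Lemma modulus_dual_le (V : normedModType K) (f : dual_space V) x :
  modulus (f x) <= rnorm f * rnorm x.
Proof. by rewrite rnorm_Lop; exact: rnorm_le_opnorm. Qed.

(** The pointwise limit along the ultrafilter exists by boundedness, and inherits linearity and
    the bound by the norm. *)
Lemma banach_alaoglu (V : normedModType K) (I : Type) (U : set_system I)
    (u : I -> dual_space V) :
  UltraFilter U -> (forall i, rnorm (u i) <= 1) ->
  exists g, weak_star_lim U u g.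
Proof.
move=> UU u1.
have ux i x : modulus (u i x) <= rnorm x.
  by apply: le_trans (modulus_dual_le _ _) _; rewrite ler_piMl ?rnorm_ge0.
have [g gP] := choice (fun x =>
  ultra_bounded_scalar (z := fun i => u i x) UU (fun i => ux i x)).
have g_uniq x l :
    (forall e : R, 0 < e -> \forall i \near U, modulus (u i x - l : K) < e) ->
    g x = l.
  move=> lP; apply/eqP; rewrite -subr_eq0; apply/eqP/modulus0_eq0.
  apply/eqP; rewrite eq_le modulus_ge0 andbT; apply/ler_addgt0Pl => e e0.
  rewrite addr0.
  have e20 : 0 < e / 2 by rewrite divr_gt0.
  have [i [A B]] := filter_ex (filterI (gP x _ e20) (lP _ e20)).
  by have := modulus_dist_le (u i x) (g x) l; lra.
have gle x : modulus (g x) <= rnorm x.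
  apply/ler_addgt0Pl => e e0; have [i A] := filter_ex (gP x _ e0).
  by have := modulus_le_dist (u i x) (g x); have := ux i x; lra.
have gL : linear (g : V -> K^o).
  move=> a x y; apply: g_uniq => e e0.
  have e' : 0 < e / 2 / (modulus a + 1).
    by rewrite !divr_gt0 // ltr_pwDr ?modulus_ge0.
  have e20 : 0 < e / 2 by rewrite divr_gt0.
  near=> i.
  have A : modulus (u i x - g x) < e / 2 / (modulus a + 1) by near: i; exact: gP.
  have B : modulus (u i y - g y) < e / 2 by near: i; exact: gP.
  have E (b c d k : K) : a * b + c - (a * d + k) = a * (b - d) + (c - k) by ring.
  rewrite linearP; rewrite [X in modulus X](E (u i x) (u i y) (g x) (g y)).
  apply: le_lt_trans (modulusD _ _) _; rewrite modulusM.
  have a0 := modulus_ge0 a.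
  have : modulus a * modulus (u i x - g x) <= e / 2.
    move: A; rewrite ltr_pdivlMr ?ltr_pwDr // => A.
    have := modulus_ge0 (u i x - g x); nra.
  lra.
have gP' : (g : V -> K^o) \in bounded_operator V K^o.
  apply/asboolP; split=> //; exists 1 => x; rewrite mul1r -!of_real_rnorm.
  by rewrite of_real_le; exact: gle.
by exists (MkLop gP') => x e e0; exact: gP.
Unshelve. all: by end_near. Qed.

End WeakStarLimits.

(** * Attainment of the norm by an operator and its adjoint *)

Section NormAttainment.
Context {R : realType} {s : scalar_kind}.
Notation K := (scalar_field R s).

Lemma rnorm_seminorm (V : normedModType K) : seminorm (@rnorm R s V).
Proof. by split=> [x y|a x]; [exact: rnormD|rewrite rnormZ]. Qed.

Lemma norm_le1 (V : normedModType K) (v : V) : (`|v| <= 1) = (rnorm v <= 1).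
Proof. by rewrite -of_real_rnorm -(@of_real1 R s) of_real_le. Qed.

Lemma dual_rnorm_le (V : normedModType K) (f : dual_space V) (c : R) :
  (forall x, rnorm x <= 1 -> modulus (f x) <= c) -> rnorm f <= c.
Proof.
by move=> fc; rewrite rnorm_Lop; apply: opnorm_le => x; rewrite norm_le1; exact: fc.
Qed.

Lemma norming_functional (V : normedModType K) (v : V) :
  exists2 f : dual_space V, rnorm f <= 1 & rnorm v <= modulus (f v).
Proof.
have [f f1 fv] := hahn_banach v (@rnorm_seminorm V) (fun x => lexx _).
by exists f => //; apply: dual_rnorm_le => x; exact: le_trans (f1 x).
Qed.

Lemma almost_norming_vector (V : normedModType K) (f : dual_space V) (e : R) :
  0 < e -> exists2 x, rnorm x <= 1 & rnorm f - e < modulus (f x).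
Proof.
move=> e0; have [_ [x x1 <-] xe] := sup_adherent e0 (opnorm_has_sup f).
by exists x; [rewrite -norm_le1|rewrite rnorm_Lop].
Qed.

(** The nontrivial inequality uses functionals that norm the vectors [T x]. *)
Lemma opnorm_adjoint (X Y : normedModType K) (T : Lop X Y) :
  opnorm T = opnorm (adjoint T).
Proof.
apply/eqP; rewrite eq_le; apply/andP; split.
  apply: opnorm_le => x; rewrite norm_le1 => x1.
  have [f f1 /le_trans] := norming_functional (T x); apply.
  apply: le_trans (modulus_dual_le (adjoint T f) x) _.
  apply: le_trans (ler_piMr (rnorm_ge0 _) x1) _.
  by apply: opnorm_ub; rewrite norm_le1.
apply: opnorm_le => f; rewrite norm_le1 => f1.
apply: dual_rnorm_le => x x1; apply: le_trans (modulus_dual_le f (T x)) _.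
apply: le_trans (ler_piMl (rnorm_ge0 _) f1) _.
by apply: opnorm_ub; rewrite norm_le1.
Qed.

Lemma attains_normP (X Y : normedModType K) (T : Lop X Y) :
  attains_norm T <-> exists x, rnorm x = 1 /\ rnorm (T x) = opnorm T.
Proof.
split=> -[x [x1 Tx]]; exists x; split.
- by rewrite /rnorm x1 real_part1.
- by rewrite /rnorm Tx Lop_normE of_realK.
- by rewrite -of_real_rnorm x1 of_real1.
- by rewrite -of_real_rnorm Tx Lop_normE.
Qed.

(** If [T] attains its norm at [x], then [T*] attains it at a functional norming [T x]. *)
Lemma adjoint_attains_norm (X Y : normedModType K) (T : Lop X Y) :
  0 < opnorm T -> attains_norm T -> attains_norm (adjoint T).
Proof.
move=> T0 /attains_normP[x [x1 Tx]]; apply/attains_normP.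
have [f f1 fTx] := norming_functional (T x); exists f.
have := modulus_dual_le f (T x); rewrite Tx in fTx * => fle.
split.
  apply/eqP; rewrite eq_le f1 /= -(ler_pM2r T0) mul1r.
  exact: le_trans fTx fle.
apply/eqP; rewrite eq_le opnorm_ub ?norm_le1 //= -opnorm_adjoint.
apply: le_trans fTx _.
by have := modulus_dual_le (adjoint T f) x; rewrite x1 mulr1.
Qed.

Lemma zero_operator_attains_norm (X Y : normedModType K) (T : Lop X Y) (v : X) :
  v != 0 -> opnorm T = 0 -> attains_norm T.
Proof.
move=> v0 T0; exists (`|v|^-1 *: v); split.
  by rewrite normrZ normfV normr_id mulVf ?normr_eq0.
rewrite Lop_normE T0 -of_real_rnorm; congr of_real.
apply/eqP; rewrite eq_le rnorm_ge0 andbT.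
by have := rnorm_le_opnorm T (`|v|^-1 *: v); rewrite T0 mul0r.
Qed.

(** The strict inequality between limits superior leaves room for a constant [c < 1], which is
    what the estimates need. *)
Lemma limsup_along_lt1 (I : Type) (F : set_system I) (a b : I -> R) :
  Filter F -> (forall i, b i <= 1) -> (limsup_along F a < limsup_along F b)%E ->
  exists2 c, c < 1 & \forall i \near F, a i <= c.
Proof.
move=> FF b1 ab.
have : (limsup_along F a < 1%:E)%E.
  apply: lt_le_trans ab _; apply: le_trans (ereal_inf_lbound _) _.
    by exists setT; [exact: filterT|reflexivity].
  by apply: ub_ereal_sup => _ [i _ <-]; rewrite lee_fin.
move=> /ereal_inf_lt[_ [A FA <-]] sup1.
have le_sup i : A i -> ((a i)%:E <= ereal_sup [set (a i)%:E | i in A])%E.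
  by move=> Ai; apply: ereal_sup_ubound; exists i.
case: ereal_sup sup1 le_sup => [c c1 le_c|//|_ le_c].
  by exists c => //; apply: filterS FA => i /le_c.
by exists 0 => //; apply: filterS FA => i /le_c.
Qed.

(** This is where the hypothesis on contractions acts.  If [z] were weakly null, then
    [g (T (z i))] would tend to 0, so that [(w i - g) (T (z i))] would be as close to the norm
    of [T] as [w i (T (z i))] is, although the hypothesis keeps [T* (w i - g)] below a fraction
    [c < 1] of this norm. *)
Lemma limsup_adjoint_lt_not_weakly_null (X Y : normedModType K) (T : Lop X Y)
    (I : Type) (F : set_system I) (w : I -> dual_space Y) (z : I -> X)
    (g : dual_space Y) :
  ProperFilter F -> 0 < opnorm T ->
  (forall i, rnorm (w i) <= 1) -> (forall i, rnorm (z i) <= 1) ->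
  (forall e : R, 0 < e ->
     \forall i \near F, opnorm T - e < modulus (w i (T (z i)))) ->
  limsup_adjoint_lt ((of_real (opnorm T))^-1 *: T) g F (fun i => w i - g) ->
  ~ weakly_null F z.
Proof.
move=> FF T0 w1 z1 wTz lt zw.
set t := opnorm T in T0 wTz lt.
have [|c c1 cP] := limsup_along_lt1 _ _ lt.
  by move=> i; rewrite addrC subrK.
(* The gap [t - t * c] between the two estimates is shared by the error terms
   [g (T (z i))] and [t - w i (T (z i))]. *)
have tc0 : 0 < t * (1 - c) / 2 by rewrite divr_gt0 // mulr_gt0 // subr_gt0.
have gTz : \forall i \near F, modulus (g (T (z i))) < t * (1 - c) / 2.
  have /cvg_modulusP/(_ _ tc0) := zw (adjoint T g).
  by apply: filterS => i; rewrite subr0.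
have [i [[A B] C]] := filter_ex (filterI (filterI cP gTz) (wTz _ tc0)).
set S := _ *: T in A.
have : modulus ((w i - g) (S (z i))) <= c.
  apply: le_trans (modulus_dual_le (adjoint S (w i - g)) (z i)) _.
  exact: le_trans (ler_piMr (rnorm_ge0 _) (z1 i)) A.
have tK : of_real t != 0 :> K.
  by rewrite -(@of_real0 R s) (inj_eq (@of_real_inj R s)) gt_eqF.
have -> : (w i - g) (S (z i)) = (of_real t)^-1 * (w i (T (z i)) - g (T (z i))) :> K.
  rewrite /S; change ((w i (((of_real t)^-1 : K) *: T (z i)) : K) -
    g (((of_real t)^-1 : K) *: T (z i)) = (of_real t)^-1 * (w i (T (z i)) - g (T (z i)))).
  by rewrite 2!linearZ /= [RHS]mulrBr.
rewrite modulusM.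
have tV : modulus (of_real t : K)^-1 = t^-1.
  apply: (@mulfI _ t); first by rewrite gt_eqF.
  rewrite mulfV ?gt_eqF // -{1}(gtr0_norm T0) -(@modulus_of_real R s) -modulusM.
  by rewrite mulfV // modulus1.
rewrite tV ler_pdivrMl // => D.
have := modulus_le_dist (g (T (z i))) (w i (T (z i))).
have E : modulus (g (T (z i)) - w i (T (z i)) : K) <= t * c by rewrite -modulusN opprB.
by move: B C; lra.
Qed.

Lemma maximizing_sequenceP (X Y : normedModType K) (T : Lop X Y) (u : nat -> X) :
  maximizing_sequence T u <->
  (forall n, rnorm (u n) <= 1) /\
  (forall e : R, 0 < e -> \forall n \near \oo, opnorm T - e < rnorm (T (u n))).
Proof.
have E n : modulus (`|T (u n)| - `|T| : K) = `|rnorm (T (u n)) - opnorm T|.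
  by rewrite Lop_normE -of_real_rnorm -of_realN -of_realD modulus_of_real.
split=> -[u1 uT]; split.
- by move=> n; rewrite -norm_le1; exact: u1.
- move=> e e0; have /(@cvg_modulusP R s)/(_ _ e0) := uT.
  by apply: filterS => n; rewrite E ltr_norml => /andP[+ _]; lra.
- by move=> n; rewrite /closed_unit_ball /= norm_le1.
- apply/(@cvg_modulusP R s) => e e0; apply: filterS (uT _ e0) => n uTn.
  rewrite E ltr_norml; apply/andP; split; first by lra.
  rewrite ltrBlDr; apply: le_lt_trans (opnorm_ub _ _) _; first by rewrite norm_le1.
  by lra.
Qed.

(** The family [u \o nu] along [F] stands both for a subnet and for a subsequence of [u]. The
    vectors at which the functionals [T* (u n)] almost attain their norms form a maximizing
    sequence of [T]. *)
Lemma adjoint_attains_of_limsup_lt (X Y : normedModType K) (T : Lop X Y)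
    (u : nat -> dual_space Y) (I : Type) (F : set_system I) (nu : I -> nat)
    (g : dual_space Y) :
  WMP X Y -> 0 < opnorm T -> maximizing_sequence (adjoint T) u ->
  ProperFilter F -> nu i @[i --> F] --> \oo ->
  limsup_adjoint_lt ((of_real (opnorm T))^-1 *: T) g F (fun i => u (nu i) - g) ->
  attains_norm (adjoint T).
Proof.
move=> wmp T0 /maximizing_sequenceP[u1 uT] FF nuF lt.
have eps0 n : 0 < n.+1%:R^-1 :> R by rewrite invr_gt0.
have [|z zP] := @choice _ _ (fun n x => rnorm x <= 1 /\
    rnorm (adjoint T (u n)) - n.+1%:R^-1 < modulus (u n (T x))).
  move=> n.
  by have [x x1 xn] := almost_norming_vector (adjoint T (u n)) (eps0 n); exists x.
have uTz (e : R) : 0 < e ->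
    \forall n \near \oo, opnorm T - e < modulus (u n (T (z n))).
  move=> e0; have e20 : 0 < e / 2 by rewrite divr_gt0.
  near=> n.
  have A : opnorm (adjoint T) - e / 2 < rnorm (adjoint T (u n)).
    by near: n; exact: uT.
  have B : n.+1%:R^-1 < e / 2 by near: n; exact: near_infty_natSinv_lt (PosNum e20).
  have [_] := zP n; apply: le_lt_trans; rewrite opnorm_adjoint.
  by rewrite [e]splitr opprD addrA (lerB (ltW A) (ltW B)).
apply: adjoint_attains_norm => //; apply: wmp; exists z; split.
  apply/maximizing_sequenceP; split=> [n|e e0]; first by case: (zP n).
  apply: filterS (uTz e e0) => n /lt_le_trans; apply.
  apply: le_trans (modulus_dual_le (u n) (T (z n))) _.
  exact: ler_piMl (rnorm_ge0 _) (u1 n).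
move=> zw.
apply: (@limsup_adjoint_lt_not_weakly_null _ _ T I F (u \o nu) (z \o nu) g) => //.
- by move=> i; exact: u1.
- by move=> i; case: (zP (nu i)).
- by move=> e e0; exact: (nuF _ (uTz e e0)).
- by move=> f; exact: (cvg_comp _ _ nuF (zw f)).
Unshelve. all: by end_near. Qed.

End NormAttainment.

(** * Weak* sequential compactness in the dual of a reflexive space *)

Section RationalSpan.
Context {R : realType} {s : scalar_kind}.
Notation K := (scalar_field R s).
Variables (V : normedModType K) (c : nat -> K) (v : nat -> V).
Hypothesis c_dense : forall a (e : R), 0 < e -> exists m, modulus (a - c m) < e.

(** The coefficients run through a countable dense set of scalars, so these combinations form a
    countable dense subset of the span. *)
Definition dense_combination (l : seq (nat * nat)) : V :=
  \sum_(p <- l) c p.2 *: v p.1.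

(** The distance to the closed span of the [v n].  An infimum over countably many combinations
    suffices, and they are also the ones that supply the countable separating set of
    [span_dist_separated]. *)
Definition span_dist (x : V) : R :=
  inf [set rnorm (x - dense_combination l) | l in [set: seq (nat * nat)]].

Lemma span_dist_has_inf x :
  has_inf [set rnorm (x - dense_combination l) | l in [set: seq (nat * nat)]].
Proof.
split; first by exists (rnorm (x - dense_combination [::])), [::].
by exists 0 => _ [l _ <-]; exact: rnorm_ge0.
Qed.

Lemma span_dist_le x l : span_dist x <= rnorm (x - dense_combination l).
Proof. by apply: ge_inf; [case: (span_dist_has_inf x)|exists l]. Qed.

Lemma le_span_dist x a :
  (forall l, a <= rnorm (x - dense_combination l)) -> a <= span_dist x.
Proof.
move=> ale; apply: lb_le_inf; first by case: (span_dist_has_inf x).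
by move=> _ [l _ <-].
Qed.

Lemma span_dist_le_rnorm x : span_dist x <= rnorm x.
Proof.
by apply: le_trans (span_dist_le x [::]) _; rewrite /dense_combination big_nil subr0.
Qed.

(** The dense combinations are not stable under scaling, but they are up to an arbitrarily small
    error; this makes [span_dist] homogeneous. *)
Lemma dense_combination_scale (a : K) l e : 0 < e ->
  exists l', rnorm (a *: dense_combination l - dense_combination l') < e.
Proof.
elim: l e => [|[n m] l IH] e e0.
  by exists [::]; rewrite /dense_combination big_nil scaler0 subr0 rnorm0.
have e20 : 0 < e / 2 by rewrite divr_gt0.
have [l' l'P] := IH _ e20.
have vn0 : 0 < rnorm (v n) + 1 by rewrite ltr_wpDl // rnorm_ge0.
have [m' m'P] := c_dense (a * c m) (divr_gt0 e20 vn0).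
exists ((n, m') :: l').
rewrite /dense_combination !big_cons /= scalerDr scalerA opprD addrACA -scalerBl.
apply: le_lt_trans (rnormD _ _) _; rewrite rnormZ [e]splitr; apply: ler_ltD => //.
rewrite ltr_pdivlMr // in m'P; apply: le_trans (ltW m'P).
rewrite -/(modulus _) ler_wpM2l ?modulus_ge0 //; lra.
Qed.

Lemma span_dist_seminorm : seminorm span_dist.
Proof.
split=> [x y|a x].
  rewrite -lerBlDr; apply: le_span_dist => l.
  rewrite lerBlDr -lerBlDl; apply: le_span_dist => l'; rewrite lerBlDl.
  apply: le_trans (span_dist_le _ (l ++ l')) _.
  rewrite /dense_combination big_cat /= opprD addrACA; exact: rnormD.
have [->|a0] := eqVneq a 0.
  rewrite scale0r modulus0 mul0r -(rnorm0 V); exact: span_dist_le_rnorm.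
have ma0 : 0 < modulus a.
  by rewrite lt_def modulus_ge0 andbT; apply: contra_neq a0; exact: modulus0_eq0.
rewrite -ler_pdivrMl //; apply: le_span_dist => l; rewrite ler_pdivrMl //.
apply/ler_addgt0Pl => e e0; have [l' l'P] := dense_combination_scale a l e0.
apply: le_trans (span_dist_le _ l') _.
have -> : a *: x - dense_combination l' =
    a *: (x - dense_combination l) + (a *: dense_combination l - dense_combination l').
  by rewrite scalerBr addrA subrK.
apply: le_trans (rnormD _ _) _.
by rewrite [leRHS]addrC rnormZ lerD // ltW.
Qed.

Lemma span_dist_generator n : span_dist (v n) <= 0.
Proof.
apply/ler_addgt0Pl => e e0; rewrite addr0.
have vn0 : 0 < rnorm (v n) + 1 by rewrite ltr_wpDl // rnorm_ge0.
have [m mP] := c_dense 1 (divr_gt0 e0 vn0).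
apply: le_trans (span_dist_le _ [:: (n, m)]) _.
rewrite /dense_combination big_seq1 /= -{1}[v n]scale1r -scalerBl rnormZ.
rewrite ltr_pdivlMr // in mP; apply: le_trans (ltW mP).
rewrite -/(modulus _) ler_wpM2l ?modulus_ge0 //; lra.
Qed.

Lemma span_dist_approx x e : span_dist x <= 0 -> 0 < e ->
  exists l, rnorm (x - dense_combination l) < e.
Proof.
move=> x0 e0; have [_ [l _ <-] le] := inf_adherent e0 (span_dist_has_inf x).
by exists l; apply: lt_le_trans le _; rewrite -[leRHS]add0r lerD2r.
Qed.

End RationalSpan.

Section SequentialCompactness.
Context {R : realType} {s : scalar_kind}.
Notation K := (scalar_field R s).
Variable Y : normedModType K.

Lemma not_near_ultra (I : Type) (F : set_system I) (P : set I) : Filter F ->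
  ~ F P -> exists U, [/\ UltraFilter U, F `<=` U & U (~` P)].
Proof.
move=> FF nFP.
have G : ProperFilter (within (~` P) F).
  apply: Build_ProperFilter_ex => B FB.
  apply: contrapT => nB; apply: nFP; apply: (@filterS _ F _ _ _ _ FB) => i Bi.
  by apply: contrapT => nPi; apply: nB; exists i; exact: Bi.
have [U [UU GU]] := ultraFilterLemma G.
exists U; split=> //; last by apply: GU; apply: (@filterE _ F) => i.
by move=> A FA; apply: GU; apply: (@filterS _ F _ _ _ _ FA) => i.
Qed.

(** By reflexivity, a functional on the dual that vanishes on all [u n] is the evaluation at some
    [y], and [u n y = 0] for all [n] passes to weak* limits.  So Hahn-Banach leaves no weak*
    limit outside the closed span. *)
Lemma weak_star_lim_span_dist (c : nat -> K) (u : nat -> dual_space Y)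
    (I : Type) (F : set_system I) (nu : I -> nat) (h : dual_space Y) :
  (forall a (e : R), 0 < e -> exists m, modulus (a - c m) < e) ->
  reflexive_space Y -> ProperFilter F ->
  weak_star_lim F (fun i => u (nu i)) h -> span_dist c u h <= 0.
Proof.
move=> c_dense reflY FF uh.
have [phi phi_le phi_h] := hahn_banach h (span_dist_seminorm u c_dense)
  (span_dist_le_rnorm c u).
have [y yP] := reflY phi.
apply: le_trans phi_h _; rewrite yP.
apply/ler_addgt0Pl => e e0; rewrite addr0.
have [i uhi] := filter_ex (uh y e e0).
have : modulus (u (nu i) y) <= 0.
  by rewrite -yP; apply: le_trans (phi_le _) (span_dist_generator u c_dense _).
have := modulus_le_dist (u (nu i) y) (h y); lra.
Qed.

Lemma half_norming_vector (f : dual_space Y) :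
  exists2 y, rnorm y <= 1 & rnorm f <= 2 * modulus (f y).
Proof.
have [f0|f0] := eqVneq (rnorm f) 0.
  by exists 0; rewrite ?rnorm0 // f0 mulr_ge0 // modulus_ge0.
have f20 : 0 < rnorm f / 2 by rewrite divr_gt0 // lt_def f0 rnorm_ge0.
have [y y1 yf] := almost_norming_vector f f20; exists y => //; lra.
Qed.

(** A functional of the closed span is close to some combination, whose norm is controlled by its
    value at a half-norming vector; this value is small when the functional vanishes there. *)
Lemma span_dist_separated (c : nat -> K) (u : nat -> dual_space Y)
    (d : seq (nat * nat) -> Y) (h : dual_space Y) :
  (forall l, rnorm (d l) <= 1) ->
  (forall l, rnorm (dense_combination c u l) <=
     2 * modulus (dense_combination c u l (d l))) ->
  span_dist c u h <= 0 -> (forall l, h (d l) = 0) -> h = 0.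
Proof.
move=> d1 dnorm h0 hd; apply: rnorm0_eq0.
apply/eqP; rewrite eq_le rnorm_ge0 andbT; apply/ler_addgt0Pl => e e0.
rewrite addr0.
have e30 : 0 < e / 3 by rewrite divr_gt0.
have [l lP] := span_dist_approx h0 e30.
set g := dense_combination c u l in lP.
have : rnorm h <= rnorm (h - g) + rnorm g.
  by rewrite -{1}(subrK g h); exact: rnormD.
have : modulus (g (d l)) <= rnorm (h - g).
  apply: le_trans (ler_piMr (rnorm_ge0 _) (d1 l)).
  apply: le_trans (modulus_dual_le (h - g) (d l)).
  change (modulus (g (d l)) <= modulus (h (d l) - g (d l) : K)).
  by rewrite hd sub0r modulusN.
have := dnorm l; rewrite -/g; lra.
Qed.

(** The countably many half-norming vectors of the dense combinations separate the points of the
    closed span of [u].  The subsequence is chosen to converge to [g] on these vectors. Any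
    weak* cluster point of it agrees with [g] there and lies, as [g] does, in the closed span,
    so it is [g]; by compactness the whole subsequence converges to [g]. *)
Lemma eberlein (u : nat -> dual_space Y) (U : set_system nat) (g : dual_space Y) :
  reflexive_space Y -> (forall n, rnorm (u n) <= 1) ->
  UltraFilter U -> \oo `<=` U -> weak_star_lim U u g ->
  exists nu : nat -> nat,
    nu k @[k --> \oo] --> \oo /\ weak_star_lim \oo (fun k => u (nu k)) g.
Proof.
move=> reflY u1 UU ooU ug.
have [c c_dense] := @countable_dense_scalars R s.
have [|d /all_and2[d1 dnorm]] := @choice _ _ (fun l y => rnorm y <= 1 /\
    rnorm (dense_combination c u l) <= 2 * modulus (dense_combination c u l y)).
  move=> l.
  by have [y y1 yP] := half_norming_vector (dense_combination c u l); exists y.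
pose dn k : Y := oapp d 0 (unpickle k).
(* The ultrafilter limit [g] is approached on finitely many vectors at a time: the first
   [k.+1] vectors of an enumeration, up to [1 / k.+1]. *)
have [|nu nuP] := @choice _ _ (fun k n => (k <= n)%N /\
    forall i : 'I_k.+1, modulus (u n (dn i) - g (dn i) : K) < k.+1%:R^-1).
  move=> k.
  have A : \forall n \near U, (k <= n)%N by apply: ooU; exact: nbhs_infty_ge.
  have B : \forall n \near U, forall i : 'I_k.+1,
      modulus (u n (dn i) - g (dn i) : K) < k.+1%:R^-1.
    by apply: filter_forall => i; apply: ug; rewrite invr_gt0.
  by have [n []] := filter_ex (filterI A B); exists n.
exists nu; split.
  by apply/cvgnyPge => N; near=> k; apply: leq_trans (nuP k).1; near: k; exact: nbhs_infty_ge.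
move=> y e e0; apply: contrapT => /not_near_ultra[W [WW ooW We]].
have [h hP] := banach_alaoglu WW (fun k => u1 (nu k)).
suff gh : h - g = 0.
  have [k [/= A B]] := filter_ex (filterI We (hP y e e0)).
  by apply: A; move/eqP : gh; rewrite subr_eq0 => /eqP <-.
apply: (span_dist_separated d1 dnorm) => [|l].
  have h0 : span_dist c u h <= 0.
    exact: weak_star_lim_span_dist c_dense reflY _ hP.
  have g0 : span_dist c u g <= 0.
    exact: (weak_star_lim_span_dist (nu := id) c_dense reflY _ ug).
  exact: seminormB_le0 (span_dist_seminorm u c_dense) h0 g0.
change (h (d l) - g (d l) = 0 :> K).
apply: modulus0_eq0; apply/eqP; rewrite eq_le modulus_ge0 andbT.
apply/ler_addgt0Pl => e' e'0; rewrite addr0.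
have e20 : 0 < e' / 2 by rewrite divr_gt0.
have A : \forall k \near W, modulus (u (nu k) (d l) - g (d l) : K) < e' / 2.
  apply: ooW; near=> k.
  have lk : (pickle l < k.+1)%N by rewrite ltnS; near: k; exact: nbhs_infty_ge.
  have E : dn (Ordinal lk) = d l by rewrite /dn pickleK.
  have := (nuP k).2 (Ordinal lk); rewrite E => /lt_trans; apply.
  near: k; exact: near_infty_natSinv_lt (PosNum e20).
have [k [B C]] := filter_ex (filterI A (hP (d l) _ e20)).
have := modulus_dist_le (u (nu k) (d l)) (h (d l)) (g (d l)); lra.
Unshelve. all: by end_near. Qed.

End SequentialCompactness.

(** * From clusters of maximizing sequences to the maximizing property *)

Section MaximizingProperties.
Context {R : realType} {s : scalar_kind}.
Notation K := (scalar_field R s).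

Lemma bounded_sub_range (V : normedModType K) (I : Type) (w : I -> V) (g : V) :
  (forall i, rnorm (w i) <= 1) -> bounded_set (range (fun i => w i - g)).
Proof.
move=> w1; exists (1 + `|g|); split; first by rewrite ger0_real // addr_ge0.
move=> M gM _ [i _ <-]; apply: ltW; apply: le_lt_trans gM.
by apply: le_trans (ler_normB _ _) _; rewrite lerD2r norm_le1.
Qed.

Lemma normalized_contraction (X Y : normedModType K) (T : Lop X Y) :
  0 < opnorm T -> Defs.contraction ((of_real (opnorm T))^-1 *: T).
Proof.
move=> T0; rewrite /Defs.contraction normrZ normfV Lop_normE -of_real_modulus.
rewrite modulus_of_real gtr0_norm // mulVf //.
by rewrite -(@of_real0 R s) (inj_eq (@of_real_inj R s)) gt_eqF.
Qed.

Lemma weak_star_lim_sub (V : normedModType K) (I : Type) (F : set_system I)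
    (w : I -> dual_space V) (g : dual_space V) :
  Filter F -> weak_star_lim F w g -> weakly_star_null F (fun i => w i - g).
Proof.
move=> FF wg x; apply/cvg_modulusP => e e0.
by apply: filterS (wg x e e0) => i; rewrite subr0.
Qed.

(** If [u n x] does not tend to 0, some ultrafilter keeps it away from 0, and so is the value at
    [x] of the limit along this ultrafilter. *)
Lemma nonzero_weak_star_cluster (V : normedModType K) (u : nat -> dual_space V) :
  (forall n, rnorm (u n) <= 1) -> ~ weakly_star_null \oo u ->
  exists U g, [/\ UltraFilter U, \oo `<=` U, weak_star_lim U u g & g <> 0].
Proof.
move=> u1 /existsNP[x /cvg_modulusP /existsNP[e /not_implyP[e0]]].
move=> /not_near_ultra[U [UU ooU Ue]].
have [g gP] := banach_alaoglu UU u1; exists U, g; split=> // g0.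
have [n [/= A B]] := filter_ex (filterI Ue (gP x e e0)).
by apply: A; rewrite subr0; move: B; rewrite g0 subr0.
Qed.

(** Index by the pairs of a member [A] of the ultrafilter and a point of [A], ordered by reverse
    inclusion of the first components: the tail of a pair stays in its set. *)
Lemma ultrafilter_net (I : Type) (U : set_system I) : UltraFilter U ->
  exists (J : Type) (le : J -> J -> Prop) (nu : J -> I),
    directed le /\ forall A, U A -> tails le (nu @^-1` A).
Proof.
move=> UU; pose J := {p : set I * I | U p.1 /\ p.1 p.2}.
exists J, (fun p q => (sval q).1 `<=` (sval p).1), (fun p => (sval p).2).
have point A : U A -> exists p : J, (sval p).1 = A.
  by move=> UA; have [i Ai] := filter_ex UA; exists (exist _ (A, i) (conj UA Ai)).
split; first split.
- by have [p _] := point _ filterT.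
- by move=> p.
- by move=> p q r pq qr; exact: subset_trans qr pq.
- move=> p q; have [r rE] := point _ (filterI (svalP p).1 (svalP q).1).
  by exists r; rewrite rE; split=> i [].
move=> A UA; have [p pE] := point _ UA; exists p => // q /= qp.
by rewrite -pE; apply: qp; exact: (svalP q).2.
Qed.

Lemma sOstar_WMP_weak_star_MP (X Y : normedModType K) :
  property_sOstar X Y -> WMP X Y -> weak_star_to_weak_star_MP X Y.
Proof.
move=> sO wmp T [u [umax unull]].
have [u1 _] := (maximizing_sequenceP _ _).1 umax.
have [U [g [UU ooU ug g0]]] := nonzero_weak_star_cluster u1 unull.
have [T0|Tn0] := eqVneq (opnorm T) 0.
  by apply: (zero_operator_attains_norm (v := g)); [exact/eqP|rewrite -opnorm_adjoint].
have Tp : 0 < opnorm T by rewrite lt_def Tn0 opnorm_ge0.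
have [J [le [nu [dle nuU]]]] := ultrafilter_net UU.
have FF := tails_proper dle.
apply: (adjoint_attains_of_limsup_lt (F := tails le) (nu := nu) (g := g) wmp Tp umax).
  by move=> A /ooU; exact: nuU.
apply: (sO _ (normalized_contraction Tp)) => //.
  by apply: bounded_sub_range => j; exact: u1.
by apply: weak_star_lim_sub => x e e0; exact: (nuU _ (ug x e e0)).
Qed.

Lemma reflexive_Ostar_WMP_weak_star_MP (X Y : normedModType K) :
  reflexive_space Y -> property_Ostar X Y -> WMP X Y ->
  weak_star_to_weak_star_MP X Y.
Proof.
move=> reflY Os wmp T [u [umax unull]].
have [u1 _] := (maximizing_sequenceP _ _).1 umax.
have [U [g [UU ooU ug g0]]] := nonzero_weak_star_cluster u1 unull.
have [T0|Tn0] := eqVneq (opnorm T) 0.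
  by apply: (zero_operator_attains_norm (v := g)); [exact/eqP|rewrite -opnorm_adjoint].
have Tp : 0 < opnorm T by rewrite lt_def Tn0 opnorm_ge0.
have [nu [nuoo nug]] := eberlein reflY u1 UU ooU ug.
apply: (adjoint_attains_of_limsup_lt (nu := nu) (g := g) wmp Tp umax _ nuoo).
apply: (Os _ (normalized_contraction Tp)) => //.
exact: weak_star_lim_sub.
Qed.

End MaximizingProperties.

Theorem theorem4p8 (R : realType) (s : scalar_kind)
    (X Y : completeNormedModType (scalar_field R s)) :
  (property_sOstar X Y -> WMP X Y -> weak_star_to_weak_star_MP X Y) /\
  (reflexive_space Y -> property_Ostar X Y -> WMP X Y ->
     weak_star_to_weak_star_MP X Y).
Proof.
split; first exact: sOstar_WMP_weak_star_MP.
exact: reflexive_Ostar_WMP_weak_star_MP.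
Qed.
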